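(* Let $\rho$ be a density model over $\mathcal S_G\times\mathcal A$ and let $\phi:\mathcal S_G\to\mathcal S_A$ be a state abstraction. Suppose there exist constants $a,b,c,d>0$ such that for all $n\ge 1$, all sequences $s_{1:n}\in\mathcal S_G^n$, $u_{1:n}\in\mathcal A^n$ and all $(\bar s,u)\in\mathcal S_A\times\mathcal A$, $$(1)\quad a\,\mu^{\mathrm A}_n(\bar s,u)\le\rho^{\mathrm A}_n(\bar s,u)\le b\,\mu^{\mathrm A}_n(\bar s,u),\qquad\qquad (2)\quad c\le\frac{\mu^{\mathrm A\prime}_n(\bar s,u)-\mu^{\mathrm A}_n(\bar s,u)}{\rho^{\mathrm A\prime}_n(\bar s,u)-\rho^{\mathrm A}_n(\bar s,u)}\le d$$ ((2) being required whenever the denominator is nonzero). Then for all such $n$, sequences and $(\bar s,u)$ for which the pseudo-count is defined (i.e. $\rho^{\mathrm A\prime}_n(\bar s,u)\ne\rho^{\mathrm A}_n(\bar s,u)$), $$a^2c\,N^{\mathrm A}_n(\bar s,u)\le\hat N^{\mathrm A}_n(\bar s,u)\le b^2d\,N^{\mathrm A}_n(\bar s,u).$$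
   Context: $\mathcal S_G,\mathcal A$ are finite sets, $\phi:\mathcal S_G\to\mathcal S_A$ is onto, $G(\bar s)=\{g\in\mathcal S_G:\phi(g)=\bar s\}$. Actions are denoted $u$ to distinguish them from the constant $a$. A density model assigns to each pair of finite sequences $s_{1:n},u_{1:n}$ a probability distribution $\rho_n(\cdot,\cdot)=\rho(\cdot,\cdot;s_{1:n},u_{1:n})$ on $\mathcal S_G\times\mathcal A$. $N_n(s,u)$ is the number of occurrences of $(s,u)$ in the sequence $(s_i,u_i)_{i\le n}$ and $\mu_n(s,u)=N_n(s,u)/n$. Abstract versions: $\rho^{\mathrm A}_n(\bar s,u)=\sum_{s\in G(\bar s)}\rho_n(s,u)$, $\mu^{\mathrm A}_n(\bar s,u)=\sum_{s\in G(\bar s)}\mu_n(s,u)$, $N^{\mathrm A}_n(\bar s,u)=\sum_{s\in G(\bar s)}N_n(s,u)$. A prime denotes the value at the same pair after one additional observation of that pair: $\rho^{\mathrm A\prime}_n(\bar s,u)$ and $\mu^{\mathrm A\prime}_n(\bar s,u)$ are the values of the abstract densities at $(\bar s,u)$ after the sequences are extended to $s_{1:n}s$, $u_{1:n}u$ with $s\in G(\bar s)$ (the assumption and conclusion hold for whichever $s\in G(\bar s)$ is appended). Models are learning-positive: $\rho^{\mathrm A\prime}_n(\bar s,u)\ge\rho^{\mathrm A}_n(\bar s,u)$. The pseudo-count $\hat N^{\mathrm A}_n(\bar s,u)$ and pseudo-count total $\hat n^{\mathrm A}$ are defined by $\rho^{\mathrm A}_n(\bar s,u)=\hat N^{\mathrm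 A}_n(\bar s,u)/\hat n^{\mathrm A}$ and $\rho^{\mathrm A\prime}_n(\bar s,u)=(\hat N^{\mathrm A}_n(\bar s,u)+1)/(\hat n^{\mathrm A}+1)$, i.e. $$\hat N^{\mathrm A}_n(\bar s,u)=\frac{\rho^{\mathrm A}_n(\bar s,u)\,(1-\rho^{\mathrm A\prime}_n(\bar s,u))}{\rho^{\mathrm A\prime}_n(\bar s,u)-\rho^{\mathrm A}_n(\bar s,u)}.$$ *)

(* Defs.v *)
From HB Require Import structures.
From mathcomp Require Import all_boot all_order all_algebra.
From mathcomp Require Import ring.
Set Implicit Arguments.
Unset Strict Implicit.
Unset Printing Implicit Defensive.
Import Order.TTheory GRing.Theory Num.Theory.
Local Open Scope ring_scope.

(* A history of length n is a pair of tuples: states s_1, ..., s_n and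
   actions u_1, ..., u_n. *)
Record density_model (R : realFieldType) (SG A : finType) := DensityModel {
  density :> forall n : nat, n.-tuple SG -> n.-tuple A -> SG -> A -> R;
  density_ge0 : forall (n : nat) (ss : n.-tuple SG) (us : n.-tuple A)
    (s : SG) (u : A), 0 <= density ss us s u;
  density_sum1 : forall (n : nat) (ss : n.-tuple SG) (us : n.-tuple A),
    \sum_(s : SG) \sum_(u : A) density ss us s u = 1
}.

Definition occ (SG A : finType) (n : nat) (ss : n.-tuple SG) (us : n.-tuple A)
    (s : SG) (u : A) : nat :=
  #|[set i : 'I_n | (tnth ss i == s) && (tnth us i == u)]|.

(* Division by zero gives mu_0 = 0; only n >= 1 is meaningful. *)
Definition empirical (R : realFieldType) (SG A : finType) (n : nat)
    (ss : n.-tuple SG) (us : n.-tuple A) (s : SG) (u : A) : R :=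
  (occ ss us s u)%:R / n%:R.

Definition fibre (SG SA : finType) (phi : SG -> SA) (sb : SA) : {set SG} :=
  [set g | phi g == sb].

(* V is the field of scalars for densities, and nat for counts. *)
Definition abstr (V : nmodType) (SG SA A : finType) (phi : SG -> SA)
    (f : SG -> A -> V) (sb : SA) (u : A) : V :=
  \sum_(s in fibre phi sb) f s u.

Section Abstract.
Variables (R : realFieldType) (SG SA A : finType) (phi : SG -> SA).
Variable rho : density_model R SG A.
Variables (n : nat) (ss : n.-tuple SG) (us : n.-tuple A).

Definition rhoA (sb : SA) (u : A) : R := abstr phi (rho n ss us) sb u.
Definition muA (sb : SA) (u : A) : R := abstr phi (empirical R ss us) sb u.
Definition NA (sb : SA) (u : A) : nat := abstr phi (occ ss us) sb u.

End Abstract.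

(* Primed values: the history is extended by (s, u). They are meaningful only
   when the appended ground state s lies in fibre phi sb. *)
Section Prime.
Variables (R : realFieldType) (SG SA A : finType) (phi : SG -> SA).
Variable rho : density_model R SG A.
Variables (n : nat) (ss : n.-tuple SG) (us : n.-tuple A).

Definition rhoA' (s : SG) (sb : SA) (u : A) : R :=
  rhoA phi rho (rcons_tuple ss s) (rcons_tuple us u) sb u.
Definition muA' (s : SG) (sb : SA) (u : A) : R :=
  muA R phi (rcons_tuple ss s) (rcons_tuple us u) sb u.

End Prime.

(* Only histories of length n >= 1 are constrained. *)
Definition learning_positive (R : realFieldType) (SG SA A : finType)
    (phi : SG -> SA) (rho : density_model R SG A) : Prop :=
  forall (n : nat) (ss : n.-tuple SG) (us : n.-tuple A) (sb : SA) (u : A)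
      (s : SG),
    (1 <= n)%N -> s \in fibre phi sb ->
    rhoA phi rho ss us sb u <= rhoA' phi rho ss us s sb u.

(* The solution (N, m) of p = N / m, p' = (N + 1) / (m + 1) (pseudo_countP);
   if p' != p and p' = 1 the formula still makes sense and gives N = m = 0. *)
Definition pseudo_count (R : realFieldType) (p p' : R) : R :=
  p * (1 - p') / (p' - p).
Definition pseudo_total (R : realFieldType) (p p' : R) : R :=
  (1 - p') / (p' - p).

Lemma pseudo_countP (R : realFieldType) (p p' N m : R) :
  p' != p -> p != 1 -> p' != 1 ->
  [/\ m != 0, m + 1 != 0, p = N / m & p' = (N + 1) / (m + 1)] <->
  N = pseudo_count p p' /\ m = pseudo_total p p'.
Proof.
rewrite /pseudo_count /pseudo_total -subr_eq0 => d0 p1 p'1.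
have q1 : 1 - p != 0 by rewrite subr_eq0 eq_sym.
have q'1 : 1 - p' != 0 by rewrite subr_eq0 eq_sym.
split=> [[m0 m1 e e']|[-> ->]].
  have eN : N = p * m by rewrite e mulfVK.
  have em : m * (p' - p) = 1 - p'.
    have h : p' * (m + 1) = N + 1 by rewrite e' mulfVK.
    rewrite eN in h.
    have -> : m * (p' - p) = p' * (m + 1) - p * m - p' by ring.
    by rewrite h; ring.
  have eq_m : m = (1 - p') / (p' - p) by rewrite -em mulfK.
  by split=> //; rewrite eN {1}eq_m mulrA.
have e1 : (1 - p') / (p' - p) + 1 = (1 - p) / (p' - p) by field.
have z : (1 - p) / (p' - p) != 0 by rewrite mulf_neq0 ?invr_eq0.
rewrite e1; split=> //.
- by rewrite mulf_neq0 ?invr_eq0.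
- by field; rewrite d0 q'1.
- by field; rewrite d0 q1.
Qed.

(* Main.v *)
(* With mu^A = N^A/n one has mu^A' - mu^A = (1 - mu^A')/n. Summing (1), for the
   extended history, over all pairs other than (sb, u) bounds 1 - rho^A' between
   a (1 - mu^A') and b (1 - mu^A'). Substituting these bounds, (1) and (2) in
   rho^A (1 - rho^A') / (rho^A' - rho^A), the factor
   mu^A (1 - mu^A') / (mu^A' - mu^A) = n mu^A = N^A remains. *)
Require Import Defs.
From mathcomp Require Import all_boot all_order all_algebra.
From mathcomp Require Import ring.
Set Implicit Arguments.
Unset Strict Implicit.
Unset Printing Implicit Defensive.
Import Order.TTheory GRing.Theory Num.Theory.
Local Open Scope ring_scope.

Section Counting.
Variables (SG SA A : finType) (phi : SG -> SA).

(** The fibres of [phi] partition the ground states, so abstraction preserves total mass; [V] stays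
    general so that one proof serves [muA] and [rhoA] alike. *)
Lemma sum_abstr (V : nmodType) (f : SG -> A -> V) :
  \sum_sb \sum_u abstr phi f sb u = \sum_s \sum_u f s u.
Proof.
rewrite [RHS](partition_big phi predT) //=.
apply: eq_bigr => sb _; rewrite /abstr exchange_big /=.
by apply: eq_bigl => s; rewrite inE.
Qed.

Lemma occE n (ss : n.-tuple SG) (us : n.-tuple A) s u :
  occ ss us s u = (\sum_(i < n) ((tnth ss i == s) && (tnth us i == u)))%N.
Proof. by rewrite /occ cardsE -sum1_card big_mkcond. Qed.

(** After exchanging the sums, each time index contributes to exactly one pair, the one observed at
    that time. *)
Lemma sum_occ n (ss : n.-tuple SG) (us : n.-tuple A) :
  (\sum_s \sum_u occ ss us s u)%N = n.
Proof.
under eq_bigr do under eq_bigr do rewrite occE.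
rewrite pair_big exchange_big /= -[RHS]card_ord -sum1_card.
apply: eq_bigr => i _; rewrite (bigD1 (tnth ss i, tnth us i)) //= !eqxx.
by rewrite big1 // => -[s u]; rewrite -xpair_eqE eq_sym => /negPf ->.
Qed.

Lemma occ_rcons n (ss : n.-tuple SG) (us : n.-tuple A) t v s u :
  occ (rcons_tuple ss t) (rcons_tuple us v) s u =
  (occ ss us s u + ((t == s) && (v == u)))%N.
Proof.
rewrite !occE big_ord_recr /=; congr addn.
  apply: eq_bigr => i _; rewrite !(tnth_nth t, tnth_nth v) /= !nth_rcons.
  by rewrite !size_tuple ltn_ord.
by rewrite !(tnth_nth t, tnth_nth v) /= !nth_rcons !size_tuple ltnn eqxx.
Qed.

Lemma NA_rcons n (ss : n.-tuple SG) (us : n.-tuple A) s sb u :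
  s \in fibre phi sb ->
  NA phi (rcons_tuple ss s) (rcons_tuple us u) sb u = (NA phi ss us sb u).+1.
Proof.
move=> sF; rewrite /NA /abstr.
under eq_bigr do rewrite occ_rcons eqxx andbT.
rewrite big_split /= -addn1; congr addn.
by rewrite (bigD1 s) //= eqxx big1 // => t /andP[_ /negPf]; rewrite eq_sym => ->.
Qed.

Lemma muAE (R : realFieldType) n (ss : n.-tuple SG) (us : n.-tuple A) sb u :
  muA R phi ss us sb u = (NA phi ss us sb u)%:R / n%:R.
Proof. by rewrite /muA /NA /abstr natr_sum mulr_suml. Qed.

Lemma sum_muA (R : realFieldType) n (ss : n.-tuple SG) (us : n.-tuple A) :
  (0 < n)%N -> \sum_sb \sum_u muA R phi ss us sb u = 1.
Proof.
move=> n_gt0; rewrite sum_abstr.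
under eq_bigr do rewrite -mulr_suml -natr_sum.
by rewrite -mulr_suml -natr_sum sum_occ divff // pnatr_eq0 -lt0n.
Qed.

Lemma sum_rhoA (R : realFieldType) (rho : density_model R SG A) n
    (ss : n.-tuple SG) (us : n.-tuple A) :
  \sum_sb \sum_u rhoA phi rho ss us sb u = 1.
Proof. by rewrite sum_abstr density_sum1. Qed.

End Counting.

(** Total mass 1 turns each complement into the sum over the other pairs, where the termwise bound
    applies. With a scalar on both sides, either half of a two-sided bound is an instance, one
    scalar being 1. *)
Lemma ler_compl_sum2 (R : numDomainType) (I J : finType) (f g : I -> J -> R) i j :
  \sum_k \sum_l f k l = 1 -> \sum_k \sum_l g k l = 1 ->
  forall x y, (forall k l, x * f k l <= y * g k l) ->
  x * (1 - f i j) <= y * (1 - g i j).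
Proof.
move=> f1 g1 x y fg.
have compl (h : I -> J -> R) : \sum_k \sum_l h k l = 1 ->
    1 - h i j = \sum_(p | p != (i, j)) h p.1 p.2.
  by rewrite pair_big (bigD1 (i, j)) //= => <-; rewrite addrAC subrr add0r.
rewrite (compl f) // (compl g) // !mulr_sumr.
by apply: ler_sum => -[k l] _; apply: fg.
Qed.

Theorem theorem2 (R : realFieldType) (SG SA A : finType) (phi : SG -> SA)
    (phi_onto : forall sb : SA, exists g : SG, phi g = sb)
    (rho : density_model R SG A)
    (rho_lp : learning_positive phi rho)
    (a b c d : R) (a_gt0 : 0 < a) (b_gt0 : 0 < b) (c_gt0 : 0 < c)
    (d_gt0 : 0 < d)
    (H1 : forall (n : nat) (ss : n.-tuple SG) (us : n.-tuple A)
            (sb : SA) (u : A), (1 <= n)%N ->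
          a * muA R phi ss us sb u <= rhoA phi rho ss us sb u
            <= b * muA R phi ss us sb u)
    (H2 : forall (n : nat) (ss : n.-tuple SG) (us : n.-tuple A)
            (sb : SA) (u : A) (s : SG), (1 <= n)%N -> s \in fibre phi sb ->
          rhoA' phi rho ss us s sb u != rhoA phi rho ss us sb u ->
          c <= (muA' R phi ss us s sb u - muA R phi ss us sb u)
               / (rhoA' phi rho ss us s sb u - rhoA phi rho ss us sb u)
            <= d)
    (n : nat) (ss : n.-tuple SG) (us : n.-tuple A) (sb : SA) (u : A) (s : SG) :
  (1 <= n)%N -> s \in fibre phi sb ->
  rhoA' phi rho ss us s sb u != rhoA phi rho ss us sb u ->
  a ^+ 2 * c * (NA phi ss us sb u)%:R
    <= pseudo_count (rhoA phi rho ss us sb u) (rhoA' phi rho ss us s sb u)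
    <= b ^+ 2 * d * (NA phi ss us sb u)%:R.
Proof.
move=> n_gt0 sF neq.
have /andP[p_ge p_le] := H1 n ss us sb u n_gt0.
have := H2 n ss us sb u s n_gt0 sF neq.
have q'_ge : a * (1 - muA' R phi ss us s sb u)
    <= 1 - rhoA' phi rho ss us s sb u.
  rewrite -[leRHS]mul1r.
  apply: ler_compl_sum2 (sum_muA _ _ _ _ _) (sum_rhoA _ _ _ _) _ _ _ => // k l.
  by rewrite mul1r; case/andP: (H1 n.+1 (rcons_tuple ss s) (rcons_tuple us u) k l isT).
have q'_le : 1 - rhoA' phi rho ss us s sb u
    <= b * (1 - muA' R phi ss us s sb u).
  rewrite -[leLHS]mul1r.
  apply: ler_compl_sum2 (sum_rhoA _ _ _ _) (sum_muA _ _ _ _ _) _ _ _ => // k l.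
  by rewrite mul1r; case/andP: (H1 n.+1 (rcons_tuple ss s) (rcons_tuple us u) k l isT).
(* Learning-positivity fixes the sign of the nonzero denominator, so the divisions below can be
   cleared. *)
have dp_gt0 : 0 < rhoA' phi rho ss us s sb u - rhoA phi rho ss us sb u.
  by rewrite subr_gt0 lt_def neq rho_lp.
have n0 : n%:R != 0 :> R by rewrite pnatr_eq0 -lt0n.
have n1 : 1 + n%:R != 0 :> R by rewrite nat1r pnatr_eq0.
have muE := muAE phi R ss us sb u.
have mu_ge0 : 0 <= muA R phi ss us sb u by rewrite muE divr_ge0 ?ler0n.
have NE : (NA phi ss us sb u)%:R = n%:R * muA R phi ss us sb u.
  by rewrite muE mulrC mulfVK.
(* With [N] the abstract count, [muA'] is [(N + 1) / (n + 1)]; both sides equal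
   [(n - N) / (n + 1)]. *)
have dmuE : 1 - muA' R phi ss us s sb u
    = n%:R * (muA' R phi ss us s sb u - muA R phi ss us sb u).
  by rewrite /muA' muE muAE NA_rcons // -!nat1r; field; rewrite n0 n1.
move: p_ge p_le q'_ge q'_le dp_gt0 mu_ge0; rewrite NE dmuE /pseudo_count.
set p := rhoA _ _ _ _ _ _; set p' := rhoA' _ _ _ _ _ _ _.
set m := muA _ _ _ _ _ _; set dm := _ - m.
move=> p_ge p_le q'_ge q'_le dp_gt0 m_ge0 /andP[c_le d_ge].
(* The quotient in [H2] is at least [c > 0] and its denominator is positive, hence so is its
   numerator. *)
have dm_gt0 : 0 < dm.
  by have := lt_le_trans c_gt0 c_le; rewrite pmulr_lgt0 ?invr_gt0.
have [a_ge0 b_ge0 c_ge0] := And3 (ltW a_gt0) (ltW b_gt0) (ltW c_gt0).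
have [dm_ge0 dp_ge0] := (ltW dm_gt0, ltW dp_gt0).
have n_ge0 : 0 <= n%:R :> R by [].
have p_ge0 : 0 <= p by apply: le_trans p_ge; rewrite mulr_ge0.
have q'_ge0 : 0 <= 1 - p' by apply: le_trans q'_ge; rewrite !mulr_ge0.
apply/andP; split.
  rewrite ler_pdivlMr //.
  (* The product is regrouped so that [a * m] is compared with [p] and the rest with [1 - p']: one
     [a] comes from each comparison, and [c * (p' - p) <= dm] supplies [c]. *)
  have -> : a ^+ 2 * c * (n%:R * m) * (p' - p)
    = (a * m) * (a * n%:R * (c * (p' - p))) by ring.
  apply: ler_pM => //; rewrite ?mulr_ge0 //.
  apply: le_trans q'_ge; rewrite -mulrA !ler_wpM2l //.
  by rewrite -ler_pdivlMr.
rewrite ler_pdivrMr //.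
(* Same regrouping from above; multiplying the two bounds now needs [p] and [1 - p'] to be
   nonnegative. *)
have -> : b ^+ 2 * d * (n%:R * m) * (p' - p)
  = (b * m) * (b * n%:R * (d * (p' - p))) by ring.
apply: ler_pM => //; apply: le_trans q'_le _; rewrite -mulrA !ler_wpM2l //.
by rewrite -ler_pdivrMr.
Qed.
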